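(* Let $(\mathcal A,\mathcal E)$ be a Frobenius exact category whose stable category $\underline{\mathcal A}$ is idempotent complete, and let $(\mathcal I,\mathcal J)$ be an ideal cotorsion pair of object ideals in $\mathcal A$ such that the cotorsion pair of objects $(\mathcal F,\mathcal C)=(\mathrm{Ob}(\mathcal I),\mathrm{Ob}(\mathcal J))$ is of $t$-structure type. If $\mathcal I$ is precovering (that is, every object of $\mathcal A$ has an $\mathcal I$-precover), in particular if $(\mathcal I,\mathcal J)$ is complete, then $(\mathcal F,\mathcal C)$ is complete.
   Context: Exact categories are in the sense of Quillen; $\mathrm{Ext}^1_{\mathcal A}$ is the Yoneda extension bifunctor. Frobenius means enough projectives and enough injectives, and these coincide; $\omega$ is the class of projective-injective objects. The stable category $\underline{\mathcal A}=\mathcal A/\omega$ has the same objects, with morphisms taken modulo those factoring through objects of $\omega$; it is triangulated with suspension $\Sigma$, where $\Sigma X$ is the cokernel of an inflation $X\to I$ with $I\in\omega$. A category is idempotent complete if every idempotent endomorphism splits. An ideal $\mathcal I$ of $\mathcal A$ is an additive subbifunctor of $\mathrm{Hom}_{\mathcal A}(-,-)$. $\mathrm{Ob}(\mathcal I)=\{X:1_X\in\mathcal I\}$; $\mathcal I$ is an object ideal if every morphism in $\mathcal I$ factors through an object of $\mathrm{Ob}(\mathcal I)$. For $f:X_0\to X_1$, $g:Y_0\to Y_1$, $\mathrm{Ext}^1_{\mathcal A}(f,g):\mathrm{Ext}^1_{\mathcal A}(X_1,Y_0)\to\mathrm{Ext}^1_{\mathcal A}(X_0,Y_1)$ is pullback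 along $f$ followed by pushout along $g$. Put ${}^\perp\mathcal J=\{f:\mathrm{Ext}^1_{\mathcal A}(f,g)=0\ \forall g\in\mathcal J\}$, $\mathcal I^\perp=\{g:\mathrm{Ext}^1_{\mathcal A}(f,g)=0\ \forall f\in\mathcal I\}$. $(\mathcal I,\mathcal J)$ is an ideal cotorsion pair if $\mathcal I={}^\perp\mathcal J$ and $\mathcal J=\mathcal I^\perp$. An $\mathcal I$-precover of $A$ is a morphism $p:E\to A$ in $\mathcal I$ through which every morphism in $\mathcal I$ with codomain $A$ factors. It is special if there are a conflation $0\to Y\to Z\to A\to0$ and $g:Y\to B$ in $\mathcal I^\perp$ whose pushout conflation is $0\to B\to E\xrightarrow{p}A\to0$. Dually, a $\mathcal J$-preenvelope of $A$ is a morphism $A\to D$ in $\mathcal J$ through which every morphism in $\mathcal J$ with domain $A$ factors; it is special if it is the inflation of a conflation obtained as the pullback of a conflation $0\to A\to Z\to Y\to0$ along a morphism $B\to Y$ in ${}^\perp\mathcal J$. $(\mathcal I,\mathcal J)$ is complete if every object has a special $\mathcal I$-precover and a special $\mathcal J$-preenvelope. A pair of classes of objects $(\mathcal F,\mathcal C)$ is a cotorsion pair if $\mathcal F=\{X:\mathrm{Ext}^1_{\mathcal A}(X,C)=0\ \forall C\in\mathcal C\}$ and $\mathcal C=\{Y:\mathrm{Ext}^1_{\mathcal A}(F,Y)=0\ \forall F\in\mathcal F\}$ (this holds automatically for $(\mathrm{Ob}(\mathcal I),\mathrm{Ob}(\mathcal J))$ when $(\mathcal I,\mathcal J)$ is an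 ideal cotorsion pair of object ideals). It is complete if for every $A$ there are conflations $0\to C\to F\to A\to0$ and $0\to A\to C'\to F'\to0$ with $F,F'\in\mathcal F$, $C,C'\in\mathcal C$. It is of $t$-structure type if $\mathrm{Hom}_{\underline{\mathcal A}}(F,C)=0$ for all $F\in\mathcal F$, $C\in\mathcal C$ (equivalently, $\Sigma\mathcal F\subseteq\mathcal F$). *)

(* Defs.v *)
From HB Require Import structures.
From mathcomp Require Import all_boot all_algebra.
From mathcomp Require Import boolp.

Set Implicit Arguments.
Unset Strict Implicit.
Unset Printing Implicit Defensive.

Import GRing.Theory.
Local Open Scope ring_scope.
Local Open Scope quotient_scope.

Declare Scope cat_scope.
Open Scope cat_scope.

Record preadditive := Preadditive {
  obj :> Type;
  hom : obj -> obj -> zmodType;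
  idm : forall X, hom X X;
  comp : forall X Y Z, hom Y Z -> hom X Y -> hom X Z;
  compA : forall X Y Z W (h : hom Z W) (g : hom Y Z) (f : hom X Y),
    comp h (comp g f) = comp (comp h g) f;
  comp1m : forall X Y (f : hom X Y), comp (idm Y) f = f;
  compm1 : forall X Y (f : hom X Y), comp f (idm X) = f;
  compDl : forall X Y Z (g g' : hom Y Z) (f : hom X Y),
    comp (g + g') f = comp g f + comp g' f;
  compDr : forall X Y Z (g : hom Y Z) (f f' : hom X Y),
    comp g (f + f') = comp g f + comp g f' }.

Arguments hom {p} _ _.
Arguments idm {p} X.
Arguments comp {p X Y Z} g f.
Notation "g ∘ f" := (comp g f) (at level 40, left associativity) : cat_scope.

Section Preadditive.
Variable C : preadditive.

Definition is_iso (X Y : C) (f : hom X Y) : Prop :=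
  exists g : hom Y X, g ∘ f = idm X /\ f ∘ g = idm Y.

Definition is_zero_object (Z : C) : Prop :=
  forall X : C, (forall f : hom X Z, f = 0) /\ (forall f : hom Z X, f = 0).

Definition is_biproduct (X Y B : C) (i : hom X B) (j : hom Y B)
    (p : hom B X) (q : hom B Y) : Prop :=
  [/\ p ∘ i = idm X, q ∘ j = idm Y, p ∘ j = 0, q ∘ i = 0
    & i ∘ p + j ∘ q = idm B].

Definition is_additive : Prop :=
  (exists Z : C, is_zero_object Z) /\
  (forall X Y : C, exists (B : C) (i : hom X B) (j : hom Y B)
     (p : hom B X) (q : hom B Y), is_biproduct i j p q).

Definition is_kernel (X Y Z : C) (i : hom X Y) (p : hom Y Z) : Prop :=
  p ∘ i = 0 /\
  forall (T : C) (t : hom T Y), p ∘ t = 0 -> exists! s : hom T X, i ∘ s = t.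

Definition is_cokernel (X Y Z : C) (i : hom X Y) (p : hom Y Z) : Prop :=
  p ∘ i = 0 /\
  forall (T : C) (t : hom Y T), t ∘ i = 0 -> exists! s : hom Z T, s ∘ p = t.

(*   X --i--> Y
     |f       |f'
     X' -i'-> Y'   *)
Definition is_pushout (X Y X' Y' : C) (i : hom X Y) (f : hom X X')
    (i' : hom X' Y') (f' : hom Y Y') : Prop :=
  f' ∘ i = i' ∘ f /\
  forall (T : C) (a : hom Y T) (b : hom X' T), a ∘ i = b ∘ f ->
    exists! t : hom Y' T, t ∘ f' = a /\ t ∘ i' = b.

(*   Y' -p'-> Z'
     |f'      |f
     Y --p--> Z    *)
Definition is_pullback (Y Z Y' Z' : C) (p : hom Y Z) (f : hom Z' Z)
    (p' : hom Y' Z') (f' : hom Y' Y) : Prop :=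
  p ∘ f' = f ∘ p' /\
  forall (T : C) (a : hom T Y) (b : hom T Z'), p ∘ a = f ∘ b ->
    exists! t : hom T Y', f' ∘ t = a /\ p' ∘ t = b.

Definition idempotent_complete : Prop :=
  forall (X : C) (e : hom X X), e ∘ e = e ->
    exists (Y : C) (r : hom X Y) (s : hom Y X), s ∘ r = e /\ r ∘ s = idm Y.

Definition factors_through (P : C -> Prop) (X Y : C) (f : hom X Y) : Prop :=
  exists (W : C) (a : hom X W) (b : hom W Y), P W /\ f = b ∘ a.

End Preadditive.

Record ideal (C : preadditive) := Ideal {
  mem_ideal :> forall X Y : C, hom X Y -> Prop;
  ideal0 : forall X Y : C, @mem_ideal X Y 0;
  idealB : forall (X Y : C) (f g : hom X Y),
    mem_ideal f -> mem_ideal g -> mem_ideal (f - g);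
  ideal_compl : forall (X Y Z : C) (g : hom Y Z) (f : hom X Y),
    mem_ideal f -> mem_ideal (g ∘ f);
  ideal_compr : forall (X Y Z : C) (g : hom Y Z) (f : hom X Y),
    mem_ideal g -> mem_ideal (g ∘ f) }.

Arguments mem_ideal {C} i {X Y} f.

Definition Ob (C : preadditive) (I : ideal C) (X : C) : Prop := I X X (idm X).

Definition object_ideal (C : preadditive) (I : ideal C) : Prop :=
  forall (X Y : C) (f : hom X Y), I X Y f -> factors_through (Ob I) f.

(* The quotient category C / I. *)
Section Quotient.
Variables (C : preadditive) (I : ideal C).

Section Hom.
Variables X Y : C.

Definition ideal_pred : {pred hom X Y} := fun f => `[< I X Y f >].

Lemma ideal_pred_zmod : zmod_closed ideal_pred.
Proof.
split=> [|f g /asboolP If /asboolP Ig]; apply/asboolP; first exact: ideal0.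
exact: idealB.
Qed.

HB.instance Definition _ :=
  GRing.isZmodClosed.Build (hom X Y) ideal_pred ideal_pred_zmod.

Definition qhom : zmodType := Quotient.quot ideal_pred.

Definition qpi (f : hom X Y) : qhom := \pi_(Quotient.quot ideal_pred) f.
Definition qrepr (f : qhom) : hom X Y := repr f.

Lemma qreprK f : qpi (qrepr f) = f.
Proof. exact: reprK. Qed.

Lemma qpi_eq (f g : hom X Y) : qpi f = qpi g <-> I X Y (f - g).
Proof.
split=> [/eqP|If]; rewrite /qpi.
  by rewrite -Quotient.idealrBE => /asboolP.
by apply/eqP; rewrite -Quotient.idealrBE; apply/asboolP.
Qed.

Lemma qpiD (f g : hom X Y) : qpi (f + g) = qpi f + qpi g.
Proof. exact: Quotient.pi_add. Qed.

End Hom.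

Lemma comp0l (X Y Z : C) (f : hom X Y) : (0 : hom Y Z) ∘ f = 0.
Proof. by apply: (addrI ((0 : hom Y Z) ∘ f)); rewrite -compDl !addr0. Qed.

Lemma comp0r (X Y Z : C) (g : hom Y Z) : g ∘ (0 : hom X Y) = 0.
Proof. by apply: (addrI (g ∘ (0 : hom X Y))); rewrite -compDr !addr0. Qed.

Lemma compBl (X Y Z : C) (g g' : hom Y Z) (f : hom X Y) :
  (g - g') ∘ f = g ∘ f - g' ∘ f.
Proof. by apply: (addIr (g' ∘ f)); rewrite -compDl !subrK. Qed.

Lemma compBr (X Y Z : C) (g : hom Y Z) (f f' : hom X Y) :
  g ∘ (f - f') = g ∘ f - g ∘ f'.
Proof. by apply: (addIr (g ∘ f')); rewrite -compDr !subrK. Qed.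

Definition qcomp (X Y Z : C) (g : qhom Y Z) (f : qhom X Y) : qhom X Z :=
  qpi (qrepr g ∘ qrepr f).

Lemma qcompE (X Y Z : C) (g : hom Y Z) (f : hom X Y) :
  qcomp (qpi g) (qpi f) = qpi (g ∘ f).
Proof.
set g' := qrepr (qpi g); set f' := qrepr (qpi f).
have Ig : I _ _ (g' - g) by apply/qpi_eq; rewrite qreprK.
have If : I _ _ (f' - f) by apply/qpi_eq; rewrite qreprK.
transitivity (qpi (g ∘ f')); apply/qpi_eq.
  by rewrite -compBl; apply: ideal_compr.
by rewrite -compBr; apply: ideal_compl.
Qed.

Definition qid (X : C) : qhom X X := qpi (idm X).

Lemma qcompA (X Y Z W : C) (h : qhom Z W) (g : qhom Y Z) (f : qhom X Y) :
  qcomp h (qcomp g f) = qcomp (qcomp h g) f.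
Proof. by rewrite -(qreprK h) -(qreprK g) -(qreprK f) !qcompE compA. Qed.

Lemma qcomp1m (X Y : C) (f : qhom X Y) : qcomp (qid Y) f = f.
Proof. by rewrite -(qreprK f) qcompE comp1m. Qed.

Lemma qcompm1 (X Y : C) (f : qhom X Y) : qcomp f (qid X) = f.
Proof. by rewrite -(qreprK f) qcompE compm1. Qed.

Lemma qcompDl (X Y Z : C) (g g' : qhom Y Z) (f : qhom X Y) :
  qcomp (g + g') f = qcomp g f + qcomp g' f.
Proof.
by rewrite -(qreprK g) -(qreprK g') -(qreprK f) -qpiD !qcompE -qpiD compDl.
Qed.

Lemma qcompDr (X Y Z : C) (g : qhom Y Z) (f f' : qhom X Y) :
  qcomp g (f + f') = qcomp g f + qcomp g f'.
Proof.
by rewrite -(qreprK g) -(qreprK f') -(qreprK f) -qpiD !qcompE -qpiD compDr.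
Qed.

Definition quotient_category : preadditive :=
  Preadditive qcompA qcomp1m qcompm1 qcompDl qcompDr.

End Quotient.

(* Quillen exact categories, with the axioms in the reduced form due to Keller
   and Buehler. *)
Record exact_category := ExactCategory {
  exact_base :> preadditive;
  conflation : forall X Y Z : exact_base, hom X Y -> hom Y Z -> Prop;
  inflation := fun (X Y : exact_base) (i : hom X Y) =>
    exists (Z : exact_base) (p : hom Y Z), conflation i p;
  deflation := fun (Y Z : exact_base) (p : hom Y Z) =>
    exists (X : exact_base) (i : hom X Y), conflation i p;
  exact_additive : is_additive exact_base;
  conflation_kercoker : forall (X Y Z : exact_base) (i : hom X Y) (p : hom Y Z),
    conflation i p -> is_kernel i p /\ is_cokernel i p;
  conflation_iso : forall (X Y Z X' Y' Z' : exact_base)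
    (i : hom X Y) (p : hom Y Z) (i' : hom X' Y') (p' : hom Y' Z')
    (a : hom X X') (b : hom Y Y') (c : hom Z Z'),
    is_iso a -> is_iso b -> is_iso c ->
    b ∘ i = i' ∘ a -> c ∘ p = p' ∘ b ->
    conflation i p -> conflation i' p';
  inflation_id : forall X : exact_base, inflation (idm X);
  deflation_id : forall X : exact_base, deflation (idm X);
  inflation_comp : forall (X Y Z : exact_base) (j : hom Y Z) (i : hom X Y),
    inflation j -> inflation i -> inflation (j ∘ i);
  deflation_comp : forall (X Y Z : exact_base) (q : hom Y Z) (p : hom X Y),
    deflation q -> deflation p -> deflation (q ∘ p);
  inflation_pushout : forall (X Y X' : exact_base) (i : hom X Y) (f : hom X X'),
    inflation i -> exists (Y' : exact_base) (i' : hom X' Y') (f' : hom Y Y'),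
      is_pushout i f i' f' /\ inflation i';
  deflation_pullback : forall (Y Z Z' : exact_base) (p : hom Y Z) (f : hom Z' Z),
    deflation p -> exists (Y' : exact_base) (p' : hom Y' Z') (f' : hom Y' Y),
      is_pullback p f p' f' /\ deflation p' }.

Section Exact.
Variable A : exact_category.

Definition projective (P : A) : Prop :=
  forall (Y Z : A) (p : hom Y Z) (f : hom P Z), deflation p ->
    exists g : hom P Y, p ∘ g = f.

Definition injective (E : A) : Prop :=
  forall (X Y : A) (i : hom X Y) (f : hom X E), inflation i ->
    exists g : hom Y E, g ∘ i = f.

Definition enough_projectives : Prop :=
  forall X : A, exists (P : A) (p : hom P X), projective P /\ deflation p.

Definition enough_injectives : Prop :=
  forall X : A, exists (E : A) (i : hom X E), injective E /\ inflation i.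

Definition frobenius : Prop :=
  [/\ enough_projectives, enough_injectives
    & forall X : A, projective X <-> injective X].

Definition omega (X : A) : Prop := projective X /\ injective X.

Lemma omega_factors0 (X Y : A) : factors_through omega (0 : hom X Y).
Proof.
have [[Z Z0] _] := exact_additive A.
have [Zin Zout] := Z0 Z.
exists Z, 0, 0; split; last by rewrite comp0l.
split=> [U V p f _|U V i f _]; exists 0.
  by rewrite comp0r ((Z0 V).2 f).
by rewrite comp0l ((Z0 U).1 f).
Qed.

Lemma omega_factorsB (X Y : A) (f g : hom X Y) :
  factors_through omega f -> factors_through omega g ->
  factors_through omega (f - g).
Proof.
move=> [V [a [b [[pV iV] ->]]]] [W [c [d [[pW iW] ->]]]].
have [_ /(_ V W) [B [i [j [p [q [pi1 qj1 pj0 qi0 ipjq1]]]]]]] := exact_additive A.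
exists B, (i ∘ a + j ∘ c), (b ∘ p - d ∘ q); split; last first.
  rewrite compDr !compBl !compA -(compA b p i) -(compA d q i) -(compA b p j).
  rewrite -(compA d q j) pi1 qj1 pj0 qi0.
  by rewrite !comp0r !comp0l !compm1 subr0 sub0r.
split=> [S T e h de|S T e h ie].
  have [u eu] := pV _ _ e (h ∘ i) de; have [v ev] := pW _ _ e (h ∘ j) de.
  exists (u ∘ p + v ∘ q).
  by rewrite compDr !compA eu ev -!compA -compDr ipjq1 compm1.
have [u eu] := iV _ _ e (p ∘ h) ie; have [v ev] := iW _ _ e (q ∘ h) ie.
exists (i ∘ u + j ∘ v).
by rewrite compDl -!compA eu ev !compA -compDl ipjq1 comp1m.
Qed.

Lemma omega_factors_compl (X Y Z : A) (g : hom Y Z) (f : hom X Y) :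
  factors_through omega f -> factors_through omega (g ∘ f).
Proof. by move=> [W [a [b [oW ->]]]]; exists W, a, (g ∘ b); rewrite compA. Qed.

Lemma omega_factors_compr (X Y Z : A) (g : hom Y Z) (f : hom X Y) :
  factors_through omega g -> factors_through omega (g ∘ f).
Proof. by move=> [W [a [b [oW ->]]]]; exists W, (a ∘ f), b; rewrite compA. Qed.

Definition omega_ideal : ideal A :=
  Ideal omega_factors0 omega_factorsB omega_factors_compl omega_factors_compr.

Definition stable_category : preadditive := quotient_category omega_ideal.

(* A representative Y -> ext_mid -> X of an element of Ext^1(X, Y). *)
Record extension (X Y : A) := Extension {
  ext_mid : A;
  ext_infl : hom Y ext_mid;
  ext_defl : hom ext_mid X;
  ext_conflation : conflation ext_infl ext_defl }.

Definition ext_pullback (X X' Y : A) (f : hom X' X)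
    (e : extension X Y) (e' : extension X' Y) : Prop :=
  exists h : hom (ext_mid e') (ext_mid e),
    is_pullback (ext_defl e) f (ext_defl e') h /\ h ∘ ext_infl e' = ext_infl e.

Definition ext_pushout (X Y Y' : A) (g : hom Y Y')
    (e : extension X Y) (e' : extension X Y') : Prop :=
  exists h : hom (ext_mid e) (ext_mid e'),
    is_pushout (ext_infl e) g (ext_infl e') h /\ ext_defl e' ∘ h = ext_defl e.

Definition ext_split (X Y : A) (e : extension X Y) : Prop :=
  exists s : hom X (ext_mid e), ext_defl e ∘ s = idm X.

(* Ext^1(X, Y) = 0; the zero class consists of the split extensions. *)
Definition Ext1_zero (X Y : A) : Prop := forall e : extension X Y, ext_split e.

(* Ext^1(f, g) = 0. Pullbacks and pushouts of extensions exist and are unique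
   up to equivalence, so it does not matter which ones are chosen. *)
Definition Ext1_map_zero (X0 X1 Y0 Y1 : A) (f : hom X0 X1) (g : hom Y0 Y1) : Prop :=
  forall (e : extension X1 Y0) (e' : extension X0 Y0) (e'' : extension X0 Y1),
    ext_pullback f e e' -> ext_pushout g e' e'' -> ext_split e''.

Definition left_perp (J : ideal A) (X0 X1 : A) (f : hom X0 X1) : Prop :=
  forall (Y0 Y1 : A) (g : hom Y0 Y1), J Y0 Y1 g -> Ext1_map_zero f g.

Definition right_perp (I : ideal A) (Y0 Y1 : A) (g : hom Y0 Y1) : Prop :=
  forall (X0 X1 : A) (f : hom X0 X1), I X0 X1 f -> Ext1_map_zero f g.

Definition ideal_cotorsion_pair (I J : ideal A) : Prop :=
  (forall (X Y : A) (f : hom X Y), I X Y f <-> left_perp J f) /\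
  (forall (X Y : A) (g : hom X Y), J X Y g <-> right_perp I g).

Definition precover (I : ideal A) (E X : A) (p : hom E X) : Prop :=
  I E X p /\
  forall (E' : A) (f : hom E' X), I E' X f -> exists h : hom E' E, p ∘ h = f.

Definition precovering (I : ideal A) : Prop :=
  forall X : A, exists (E : A) (p : hom E X), precover I p.

Definition special_precover (I : ideal A) (E X : A) (p : hom E X) : Prop :=
  precover I p /\
  exists (Y B : A) (g : hom Y B) (e : extension X Y) (j : hom B E)
    (jp : conflation j p),
    right_perp I g /\ ext_pushout g e (Extension jp).

Definition preenvelope (J : ideal A) (X D : A) (i : hom X D) : Prop :=
  J X D i /\
  forall (D' : A) (f : hom X D'), J X D' f -> exists h : hom D D', h ∘ i = f.

Definition special_preenvelope (J : ideal A) (X D : A) (i : hom X D) : Prop :=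
  preenvelope J i /\
  exists (Y B : A) (f : hom B Y) (e : extension Y X) (q : hom D B)
    (iq : conflation i q),
    left_perp J f /\ ext_pullback f e (Extension iq).

Definition complete_ideal_pair (I J : ideal A) : Prop :=
  (forall X : A, exists (E : A) (p : hom E X), special_precover I p) /\
  (forall X : A, exists (D : A) (i : hom X D), special_preenvelope J i).

Definition cotorsion_pair (F C : A -> Prop) : Prop :=
  (forall X : A, F X <-> (forall Y, C Y -> Ext1_zero X Y)) /\
  (forall Y : A, C Y <-> (forall X, F X -> Ext1_zero X Y)).

Definition complete_cotorsion_pair (F C : A -> Prop) : Prop :=
  [/\ cotorsion_pair F C,
      forall X : A, exists (C0 F0 : A) (i : hom C0 F0) (p : hom F0 X),
        [/\ C C0, F F0 & conflation i p]
    & forall X : A, exists (C0 F0 : A) (i : hom X C0) (p : hom C0 F0),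
        [/\ C C0, F F0 & conflation i p]].

Definition t_structure_type (F C : A -> Prop) : Prop :=
  forall X Y : A, F X -> C Y ->
    forall f : @hom stable_category X Y, f = 0.

End Exact.

(* Main.v *)
From mathcomp Require Import all_boot all_algebra.
Require Import Defs.

Set Implicit Arguments.
Unset Strict Implicit.
Unset Printing Implicit Defensive.

Import GRing.Theory.
Local Open Scope ring_scope.

(** Since both ideals are object ideals, the pair of ideals is governed by the
    pair of classes [F = Ob I] and [C = Ob J]: it is a cotorsion pair of objects
    ([Ob_cotorsion_pair]), and factoring an [I]-precover through [F] gives an
    [F]-precover ([precovering_Ob]). What remains is the fact, due in essence to
    Keller and Vossieck, that a precovering suspended subcategory of a
    triangulated category with split idempotents is an aisle.

    Dimension shifting ([Ext1_zero_stable]) says that [X] lies in [F] exactly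
    when every stable map from [X] to a suspension of an object of [C] is zero.
    Hence [F] contains [omega] and is closed under extensions and stable
    retracts; the t-structure condition makes it closed under cones
    ([left_cone]). Let [f : S -> X] be a precover by an object of [F], chosen to
    be a deflation, and let [S'] be a precover of its kernel. The cone
    [u : S -> S''] of [S' -> S] kills every stable map from [F] to [S] which [f]
    kills, and [f] factors through [u]; as [S''] is in [F], the second factor is
    [f v] for some [v : S'' -> S] ([weak_coreflection]). From [f v u = f] follows
    [u v u = u] stably, so [v u] is an idempotent of the stable category.
    Splitting it cuts down [S] to an object of [F] on which [f], besides
    remaining a precover, is injective on stable maps from [F]
    ([coreflection]).

    The kernel [C0] of such a deflation [f : S -> X] is in [C]
    ([coreflection_kernel]): an extension of [T] in [F] by [C0] becomes, by
    pushout, an extension [M] of [T] by [S], and [M] is in [F]; lifting the map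
    [M -> X] along [f] splits first this extension, by injectivity, and then the
    given one, by the precovering property. This yields the conflations
    [C0 -> S -> X]. Pulling an injective hull of [X] back along such a conflation
    for the suspension of [X] yields the other ones. *)

(** * Conflations, pullbacks and pushouts *)

Section Conflations.
Variable A : exact_category.

Lemma conflation_comp0 (X Y Z : A) (i : hom X Y) (p : hom Y Z) :
  conflation i p -> p ∘ i = 0.
Proof. by case/conflation_kercoker=> [[]]. Qed.

Lemma conflation_lift (X Y Z T : A) (i : hom X Y) (p : hom Y Z) (t : hom T Y) :
  conflation i p -> p ∘ t = 0 -> exists s, i ∘ s = t.
Proof.
by case/conflation_kercoker=> [[_ K] _] /K [s [es _]]; exists s.
Qed.

Lemma conflation_mono (X Y Z T : A) (i : hom X Y) (p : hom Y Z)
    (s s' : hom T X) :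
  conflation i p -> i ∘ s = i ∘ s' -> s = s'.
Proof.
case/conflation_kercoker=> [[pi0 K] _] ess'.
have [|s0 [_ u]] := K _ (i ∘ s'); first by rewrite compA pi0 comp0l.
by rewrite -(u _ ess') -(u _ erefl).
Qed.

Lemma conflation_desc (X Y Z T : A) (i : hom X Y) (p : hom Y Z) (t : hom Y T) :
  conflation i p -> t ∘ i = 0 -> exists s, s ∘ p = t.
Proof.
by case/conflation_kercoker=> [_ [_ K]] /K [s [es _]]; exists s.
Qed.

Lemma conflation_epi (X Y Z T : A) (i : hom X Y) (p : hom Y Z)
    (s s' : hom Z T) :
  conflation i p -> s ∘ p = s' ∘ p -> s = s'.
Proof.
case/conflation_kercoker=> [_ [pi0 K]] ess'.
have [|s0 [_ u]] := K _ (s' ∘ p); first by rewrite -compA pi0 comp0r.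
by rewrite -(u _ ess') -(u _ erefl).
Qed.

Lemma conflation_inflation (X Y Z : A) (i : hom X Y) (p : hom Y Z) :
  conflation i p -> inflation i.
Proof. by exists Z, p. Qed.

Lemma conflation_deflation (X Y Z : A) (i : hom X Y) (p : hom Y Z) :
  conflation i p -> deflation p.
Proof. by exists X, i. Qed.

Lemma is_iso_idm (X : A) : is_iso (idm X).
Proof. by exists (idm X); rewrite comp1m. Qed.

Lemma pullback_ext (Y Z Y' Z' T : A) (p : hom Y Z) (f : hom Z' Z)
    (p' : hom Y' Z') (f' : hom Y' Y) (t t' : hom T Y') :
  is_pullback p f p' f' -> f' ∘ t = f' ∘ t' -> p' ∘ t = p' ∘ t' -> t = t'.
Proof.
move=> [sq K] e1 e2.
have [|s [_ u]] := K _ (f' ∘ t') (p' ∘ t'); first by rewrite !compA sq.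
by rewrite -(u t) // -(u t').
Qed.

Lemma pushout_ext (X Y X' Y' T : A) (i : hom X Y) (f : hom X X')
    (i' : hom X' Y') (f' : hom Y Y') (t t' : hom Y' T) :
  is_pushout i f i' f' -> t ∘ f' = t' ∘ f' -> t ∘ i' = t' ∘ i' -> t = t'.
Proof.
move=> [sq K] e1 e2.
have [|s [_ u]] := K _ (t' ∘ f') (t' ∘ i'); first by rewrite -!compA sq.
by rewrite -(u t) // -(u t').
Qed.

(** The axioms provide some pullback along which the deflation survives, with
    an unspecified kernel; uniqueness of pullbacks and of kernels carries this
    over to every pullback square, with the original kernel. *)
Lemma pullback_conflation (Y E Z Z' E' : A) (k : hom Y E) (p : hom E Z)
    (f : hom Z' Z) (p' : hom E' Z') (f' : hom E' E) :
  conflation k p -> is_pullback p f p' f' ->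
  exists k' : hom Y E', f' ∘ k' = k /\ conflation k' p'.
Proof.
move=> kp pb.
have [E1 [p1 [f1 [pb1 [Y1 [k1 kp1]]]]]] :=
  deflation_pullback f (conflation_deflation kp).
have [|k' [[fk' pk'] _]] := pb.2 _ k 0.
  by rewrite (conflation_comp0 kp) comp0r.
have [phi [[fphi pphi] _]] := pb.2 _ _ _ pb1.1.
have [psi [[fpsi ppsi] _]] := pb1.2 _ _ _ pb.1.
have phipsi : phi ∘ psi = idm E'.
  by apply: (pullback_ext pb); rewrite compA ?fphi ?pphi compm1.
have psiphi : psi ∘ phi = idm E1.
  by apply: (pullback_ext pb1); rewrite compA ?fpsi ?ppsi compm1.
have [|b kb] := conflation_lift (t := f1 ∘ k1) kp.
  by rewrite compA pb1.1 -compA (conflation_comp0 kp1) comp0r.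
have [|a ka] := conflation_lift (t := psi ∘ k') kp1.
  by rewrite compA ppsi.
exists k'; split=> //.
apply: (conflation_iso (a := b) (b := phi) (c := idm Z')) (kp1).
- exists a; split; last first.
    by apply: (conflation_mono kp); rewrite compA kb -compA ka compA fpsi compm1.
  apply: (conflation_mono kp1); rewrite compA ka compm1.
  apply: (pullback_ext pb1); first by rewrite !compA fpsi fk' kb.
  by rewrite !compA ppsi pk' comp0l (conflation_comp0 kp1).
- by exists psi.
- exact: is_iso_idm.
- apply: (pullback_ext pb); first by rewrite !compA fphi fk' kb.
  by rewrite !compA pphi pk' comp0l (conflation_comp0 kp1).
- by rewrite pphi comp1m.
Qed.

Lemma pushout_conflation (X Y Z X' Y' : A) (i : hom X Y) (p : hom Y Z)
    (f : hom X X') (i' : hom X' Y') (f' : hom Y Y') :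
  conflation i p -> is_pushout i f i' f' ->
  exists p' : hom Y' Z, p' ∘ f' = p /\ conflation i' p'.
Proof.
move=> ip po.
have [Y1 [i1 [f1 [po1 [Z1 [p1 ip1]]]]]] :=
  inflation_pushout f (conflation_inflation ip).
have [|p' [[pf' pi'] _]] := po.2 _ p 0.
  by rewrite (conflation_comp0 ip) comp0l.
have [phi [[phif phii] _]] := po1.2 _ _ _ po.1.
have [psi [[psif psii] _]] := po.2 _ _ _ po1.1.
have phipsi : phi ∘ psi = idm Y'.
  by apply: (pushout_ext po); rewrite -compA ?psif ?psii ?phif ?phii comp1m.
have psiphi : psi ∘ phi = idm Y1.
  by apply: (pushout_ext po1); rewrite -compA ?phif ?phii ?psif ?psii comp1m.
have [|b bp] := conflation_desc (t := p1 ∘ f1) ip.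
  by rewrite -compA po1.1 compA (conflation_comp0 ip1) comp0l.
have [|a ap] := conflation_desc (t := p' ∘ phi) ip1.
  by rewrite -compA phii.
have bp' : b ∘ p' = p1 ∘ psi.
  apply: (pushout_ext po); first by rewrite -!compA psif pf' bp.
  by rewrite -!compA psii pi' comp0r (conflation_comp0 ip1).
exists p'; split=> //.
apply: (conflation_iso (a := idm X') (b := phi) (c := a)) (ip1).
- exact: is_iso_idm.
- by exists psi.
- exists b; split.
    by apply: (conflation_epi ip1); rewrite -compA ap compA bp' -compA psiphi
      compm1 comp1m.
  by apply: (conflation_epi ip); rewrite -compA bp compA ap -compA phif pf' comp1m.
- by rewrite phii compm1.
- by [].
Qed.

Lemma retraction_section (X Y Z : A) (i : hom X Y) (p : hom Y Z)
    (r : hom Y X) :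
  conflation i p -> r ∘ i = idm X -> exists s, p ∘ s = idm Z.
Proof.
move=> ip ri.
have [|s sp] := conflation_desc (t := idm Y - i ∘ r) ip.
  by rewrite compBl comp1m -compA ri compm1 subrr.
exists s; apply: (conflation_epi ip).
by rewrite -compA sp compBr compA (conflation_comp0 ip) comp0l subr0 compm1 comp1m.
Qed.

Lemma section_retraction (X Y Z : A) (i : hom X Y) (p : hom Y Z)
    (s : hom Z Y) :
  conflation i p -> p ∘ s = idm Z -> exists r, r ∘ i = idm X.
Proof.
move=> ip ps.
have [|r ir] := conflation_lift (t := idm Y - s ∘ p) ip.
  by rewrite compBr compm1 compA ps comp1m subrr.
exists r; apply: (conflation_mono ip).
by rewrite compA ir compBl -compA (conflation_comp0 ip) comp0r subr0 compm1 comp1m.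
Qed.

(** The projection is the pullback of [X -> 0], which is a deflation because it
    is the cokernel of [idm X]. *)
Lemma biproduct_proj_deflation (X Y B : A) (i : hom X B) (j : hom Y B)
    (p : hom B X) (q : hom B Y) :
  is_biproduct i j p q -> deflation q.
Proof.
move=> [pi1 qj1 pj0 qi0 ipjq1].
have [Z [c c_cofl]] := inflation_id X.
have c0 : c = 0 by rewrite -(compm1 c) (conflation_comp0 c_cofl).
have pb : is_pullback c (0 : hom Y Z) q p.
  split=> [|T a b _]; first by rewrite c0 !comp0l.
  exists (i ∘ a + j ∘ b); split=> [|t [pt qt]].
    rewrite !compDr !compA pi1 pj0 qi0 qj1 !comp0l !comp1m.
    by rewrite addr0 add0r.
  by rewrite -pt -qt !compA -compDl ipjq1 comp1m.
have [k' [_ kq]] := pullback_conflation c_cofl pb.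
exact: conflation_deflation kq.
Qed.

(** The map [(f, d) : X ⊕ P -> Y] is [1 ⊕ d : X ⊕ P -> X ⊕ Y], a pullback of
    [d], followed by [(f, 1) : X ⊕ Y -> Y], which is a projection of [X ⊕ Y]
    for another biproduct structure, sheared by [f]. *)
Lemma biproduct_deflation (X P B Y : A) (i : hom X B) (j : hom P B)
    (p : hom B X) (q : hom B P) (f : hom X Y) (d : hom P Y) :
  is_biproduct i j p q -> deflation d -> deflation (f ∘ p + d ∘ q).
Proof.
move=> [pi1 qj1 pj0 qi0 ipjq1] [K [k kd]].
have [_ /(_ X Y) [B' [i' [j' [p' [q' [pi1' qj1' pj0' qi0' ipjq1']]]]]]] :=
  exact_additive A.
have shear : deflation (f ∘ p' + q').
  apply: (@biproduct_proj_deflation _ _ _ (i' - j' ∘ f) j' p'); split=> //.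
  - by rewrite compBr compA pj0' comp0l subr0.
  - by rewrite compDl -compA pj0' comp0r add0r.
  - rewrite compDl !compBr -!compA pi1' (compA p') pj0' (compA q') qj1' qi0'.
    by rewrite comp0l comp0r comp1m compm1 subr0 sub0r subrr.
  - by rewrite compBl compDr addrA -compA subrK.
pose e := i' ∘ p + j' ∘ (d ∘ q).
have p'e : p' ∘ e = p by rewrite compDr !compA pi1' pj0' !comp0l comp1m addr0.
have q'e : q' ∘ e = d ∘ q by rewrite compDr !compA qi0' qj1' !comp0l comp1m add0r.
have pb : is_pullback d q' e q.
  split=> [|T a b dab]; first by rewrite q'e.
  exists (i ∘ (p' ∘ b) + j ∘ a); split=> [|t [<- <-]]; last first.
    by rewrite (compA p') p'e !compA -compDl ipjq1 comp1m.
  have qt : q ∘ (i ∘ (p' ∘ b) + j ∘ a) = a.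
    by rewrite compDr !compA qi0 qj1 !comp0l comp1m add0r.
  have pt : p ∘ (i ∘ (p' ∘ b) + j ∘ a) = p' ∘ b.
    by rewrite compDr !compA pi1 pj0 !comp0l comp1m addr0.
  split=> //; rewrite /e compDl -!compA qt pt dab.
  by rewrite !compA -compDl ipjq1' comp1m.
have [k' [_ k'e]] := pullback_conflation kd pb.
have -> : f ∘ p + d ∘ q = (f ∘ p' + q') ∘ e.
  by rewrite compDl -compA p'e q'e.
exact: deflation_comp shear (conflation_deflation k'e).
Qed.

End Conflations.

(** * Vanishing of extensions, and cotorsion pairs of objects *)

Section Ext.
Variable A : exact_category.

Lemma Ext1_zero_lift (X Y E Z : A) (k : hom Y E) (p : hom E Z) (f : hom X Z) :
  Ext1_zero X Y -> conflation k p -> exists g, p ∘ g = f.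
Proof.
move=> XY kp.
have [E' [p' [f' [pb _]]]] := deflation_pullback f (conflation_deflation kp).
have [k' [_ kp']] := pullback_conflation kp pb.
have [s /= ps] := XY (Extension kp').
by exists (f' ∘ s); rewrite compA pb.1 -compA ps compm1.
Qed.

Lemma Ext1_zero_extend (X Y Z E : A) (k : hom Z E) (p : hom E X) (f : hom Z Y) :
  Ext1_zero X Y -> conflation k p -> exists g, g ∘ k = f.
Proof.
move=> XY kp.
have [E' [k' [f' [po _]]]] := inflation_pushout f (conflation_inflation kp).
have [p' [_ kp']] := pushout_conflation kp po.
have [s /= ps] := XY (Extension kp').
have [r rk] := section_retraction kp' ps.
by exists (r ∘ f'); rewrite -compA po.1 compA rk comp1m.
Qed.

Lemma Ext1_map_zero_source (X X0 X1 Y0 Y1 : A) (a : hom X0 X) (b : hom X X1)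
    (g : hom Y0 Y1) :
  Ext1_zero X Y0 -> Ext1_map_zero (b ∘ a) g.
Proof.
move=> XY e e' e'' [h [pb _]] [h' [_ ph']].
have [l pl] := Ext1_zero_lift b XY (ext_conflation e).
have [|t [[_ pt] _]] := pb.2 _ (l ∘ a) (idm X0); first by rewrite compA pl compm1.
by exists (h' ∘ t); rewrite compA ph'.
Qed.

Lemma Ext1_map_zero_target (X0 X1 Y Y0 Y1 : A) (f : hom X0 X1) (a : hom Y0 Y)
    (b : hom Y Y1) :
  Ext1_zero X0 Y -> Ext1_map_zero f (b ∘ a).
Proof.
move=> XY e e' e'' _ [h' [po _]].
have [l lk] := Ext1_zero_extend a XY (ext_conflation e').
have [|t [[_ tk] _]] := po.2 _ (b ∘ l) (idm Y1); first by rewrite -compA lk comp1m.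
exact: retraction_section (ext_conflation e'') tk.
Qed.

Lemma Ext1_map_zero_idm (X Y : A) :
  Ext1_map_zero (idm X) (idm Y) -> Ext1_zero X Y.
Proof.
move=> XY e; apply: (XY e e e); exists (idm _).
  split; last exact: comp1m.
  split=> [|T a b ab]; first by rewrite comp1m compm1.
  by exists a; split=> [|t [<- _]]; rewrite comp1m // ab comp1m.
split; last exact: compm1.
split=> [|T a b ab]; first by rewrite comp1m compm1.
by exists a; split=> [|t [<- _]]; rewrite compm1 // ab compm1.
Qed.

(** Membership of an identity in a perpendicular ideal is tested against all
    maps of the other ideal; these factor through objects, so the identities of
    those objects already decide. *)
Lemma Ob_cotorsion_pair (I J : ideal A) :
  ideal_cotorsion_pair I J -> object_ideal I -> object_ideal J ->
  cotorsion_pair (Ob I) (Ob J).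
Proof.
move=> [IJ JI] oI oJ; split=> [X|Y].
  rewrite /Ob IJ; split=> [XJ Y JY|XJ Y0 Y1 g /oJ [W [a [b [JW ->]]]]].
    exact/Ext1_map_zero_idm/XJ.
  exact/Ext1_map_zero_target/XJ.
rewrite /Ob JI; split=> [YI X IX|YI X0 X1 f /oI [W [a [b [IW ->]]]]].
  exact/Ext1_map_zero_idm/YI.
exact/Ext1_map_zero_source/YI.
Qed.

Definition precovering_class (F : A -> Prop) : Prop :=
  forall X : A, exists (S : A) (f : hom S X),
    F S /\ forall (T : A) (t : hom T X), F T -> exists h, f ∘ h = t.

(** An [I]-precover of [X] factors through some [S] in [Ob I], and the second
    factor is then an [Ob I]-precover of [X], since every map from an object of
    [Ob I] lies in [I]. *)
Lemma precovering_Ob (I : ideal A) :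
  object_ideal I -> precovering I -> precovering_class (Ob I).
Proof.
move=> oI pI X; have [E [p [/oI [S [a [b [IS pE]]]] pP]]] := pI X.
exists S, b; split=> // T t IT.
have [|h ph] := pP T t; first by rewrite -(compm1 t); apply: ideal_compl.
by exists (a ∘ h); rewrite compA -pE.
Qed.

End Ext.

(** * The stable category *)

Section Stable.
Variable A : exact_category.

Definition stab (X Y : A) (f : hom X Y) : @hom (stable_category A) X Y :=
  qpi (omega_ideal A) f.

Lemma stab_comp (X Y Z : A) (g : hom Y Z) (f : hom X Y) :
  stab (g ∘ f) = stab g ∘ stab f.
Proof. exact/esym/qcompE. Qed.

Lemma stab_eq (X Y : A) (f g : hom X Y) :
  stab f = stab g <-> factors_through (@omega A) (f - g).
Proof. exact: qpi_eq. Qed.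

Lemma stabD (X Y : A) (f g : hom X Y) : stab (f + g) = stab f + stab g.
Proof. exact: qpiD. Qed.

Lemma stab0 (X Y : A) : stab (0 : hom X Y) = 0.
Proof. by apply: (addrI (stab 0)); rewrite -stabD !addr0. Qed.

Lemma stab_surj (X Y : A) (f : @hom (stable_category A) X Y) :
  exists g, stab g = f.
Proof. by exists (qrepr f); apply: qreprK. Qed.

Lemma stab_eq0 (X Y : A) (f : hom X Y) :
  stab f = 0 <-> factors_through (@omega A) f.
Proof. by rewrite -(stab0 X Y) stab_eq subr0. Qed.

Lemma stab_from_omega (W Y : A) (f : hom W Y) : omega W -> stab f = 0.
Proof. by move=> oW; apply/stab_eq0; exists W, (idm W), f; rewrite compm1. Qed.

Lemma stab_to_omega (X W : A) (f : hom X W) : omega W -> stab f = 0.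
Proof. by move=> oW; apply/stab_eq0; exists W, f, (idm W); rewrite comp1m. Qed.

Lemma stab0_lift (T Y Z : A) (p : hom Y Z) (f : hom T Z) :
  stab f = 0 -> deflation p -> exists2 g, p ∘ g = f & stab g = 0.
Proof.
move=> /stab_eq0 [W [a [b [oW ->]]]] dp; have [g pg] := oW.1 _ _ _ b dp.
exists (g ∘ a); first by rewrite compA pg.
by rewrite stab_comp (stab_from_omega g) // comp0l.
Qed.

Lemma stab0_extend (T X Y : A) (i : hom X Y) (f : hom X T) :
  stab f = 0 -> inflation i -> exists2 g, g ∘ i = f & stab g = 0.
Proof.
move=> /stab_eq0 [W [a [b [oW ->]]]] di; have [g gi] := oW.2 _ _ _ a di.
exists (b ∘ g); first by rewrite -compA gi.
by rewrite stab_comp (stab_from_omega b) // comp0l.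
Qed.

Lemma Ext1_zero_projective (P Y : A) : projective P -> Ext1_zero P Y.
Proof. by move=> pP e; apply: pP; apply: conflation_deflation (ext_conflation e). Qed.

(** Dimension shifting: [Ext^1(X, Y)] is the group of stable maps from [X] to
    the suspension [D] of [Y]. *)
Lemma Ext1_zero_stable (X Y W D : A) (w : hom Y W) (d : hom W D) :
  conflation w d -> omega W ->
  Ext1_zero X Y <-> forall f : hom X D, stab f = 0.
Proof.
move=> wd oW; split=> [XY f|XD e].
  have [g <-] := Ext1_zero_lift f XY wd.
  by rewrite stab_comp (stab_from_omega d) // comp0l.
have kp := ext_conflation e; set k := ext_infl e in kp; set p := ext_defl e in kp.
have [u uk] := oW.2 _ _ _ w (conflation_inflation kp).
have [|f fp] := conflation_desc (t := d ∘ u) kp.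
  by rewrite -compA uk (conflation_comp0 wd).
have [g dg _] := stab0_lift (XD f) (conflation_deflation wd).
(* The difference of the two maps from the middle term to [W] lands in [Y]
   and retracts [k]. *)
have [|r wr] := conflation_lift (t := u - g ∘ p) wd.
  by rewrite compBr compA dg fp subrr.
apply: (retraction_section (r := r) kp); apply: (conflation_mono wd).
by rewrite compA wr compBl uk -compA (conflation_comp0 kp) comp0r subr0 compm1.
Qed.

Hypothesis frobA : frobenius A.

Lemma injective_hull (X : A) : exists (W D : A) (w : hom X W) (d : hom W D),
  omega W /\ conflation w d.
Proof.
have [_ /(_ X) [W [w [iW [D [d wd]]]]] pi] := frobA.
by exists W, D, w, d; split=> //; split=> //; apply/pi.
Qed.

Lemma projective_cover (X : A) : exists (P : A) (d : hom P X),
  omega P /\ deflation d.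
Proof.
have [/(_ X) [P [d [pP dd]]] _ pi] := frobA.
by exists P, d; split=> //; split=> //; apply/pi.
Qed.

End Stable.

(** * Cotorsion pairs of t-structure type with a precovering left class *)

Section Aisle.
Variables (A : exact_category) (F C : A -> Prop).
Hypotheses (frobA : frobenius A) (cotFC : cotorsion_pair F C).

Lemma left_omega (W : A) : omega W -> F W.
Proof. by move=> [pW _]; apply/(cotFC.1 _) => Y _; apply: Ext1_zero_projective. Qed.

Lemma left_stab0 (X Y W D : A) (w : hom Y W) (d : hom W D) (f : hom X D) :
  F X -> C Y -> omega W -> conflation w d -> stab f = 0.
Proof.
move=> FX CY oW wd; move: f; apply/(Ext1_zero_stable X wd oW).
exact: (cotFC.1 X).1 FX _ CY.
Qed.

Lemma left_char (X : A) :
  (forall (Y W D : A) (w : hom Y W) (d : hom W D) (f : hom X D),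
     C Y -> omega W -> conflation w d -> stab f = 0) -> F X.
Proof.
move=> X0; apply/(cotFC.1 _) => Y CY.
have [W [D [w [d [oW wd]]]]] := injective_hull frobA Y.
by apply/(Ext1_zero_stable X wd oW) => f; apply: X0 wd.
Qed.

Lemma left_stable_retract (X S : A) (r : hom S X) (s : hom X S) :
  F S -> stab r ∘ stab s = idm (X : stable_category A) -> F X.
Proof.
move=> FS rs; apply: left_char => Y W D w d f CY oW wd.
rewrite -(compm1 (stab f)) -rs compA -stab_comp.
by rewrite (left_stab0 (f ∘ r) FS CY oW wd) comp0l.
Qed.

Lemma left_extension (X' X X'' : A) (i : hom X' X) (p : hom X X'') :
  conflation i p -> F X' -> F X'' -> F X.
Proof.
move=> ip FX' FX''; apply: left_char => Y W D w d f CY oW wd.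
have fi0 := left_stab0 (f ∘ i) FX' CY oW wd.
have [g gi g0] := stab0_extend fi0 (conflation_inflation ip).
have [|h hp] := conflation_desc (t := f - g) ip.
  by rewrite compBl gi subrr.
rewrite -(subrK g f) -hp stabD g0 addr0 stab_comp.
by rewrite (left_stab0 h FX'' CY oW wd) comp0l.
Qed.

Hypothesis tFC : t_structure_type F C.

(** Pulling an extension of [X''] by [Y] in [C] back to [X] splits it, and the
    obstruction to descending the resulting map to [X''] is a map from [X'] to
    [Y], which is stably zero by hypothesis. *)
Lemma left_cone (X' X X'' : A) (i : hom X' X) (q : hom X X'') :
  conflation i q -> F X' -> F X -> F X''.
Proof.
move=> iq FX' FX; apply/(cotFC.1 _) => Y CY e.
have kp := ext_conflation e; set k := ext_infl e in kp; set p := ext_defl e in kp.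
have [u pu] := Ext1_zero_lift q ((cotFC.1 X).1 FX Y CY) kp.
have [|v kv] := conflation_lift (t := u ∘ i) kp.
  by rewrite compA pu (conflation_comp0 iq).
have [v' v'i _] := stab0_extend (tFC FX' CY (stab v)) (conflation_inflation iq).
have [|t tq] := conflation_desc (t := u - k ∘ v') iq.
  by rewrite compBl -compA v'i kv subrr.
exists t; apply: (conflation_epi iq); rewrite -/p.
by rewrite -compA tq compBr pu compA (conflation_comp0 kp) comp0l subr0 comp1m.
Qed.

Hypothesis preF : precovering_class F.

(** Adding a projective cover of [X] to the domain turns [f] into a deflation
    and changes nothing stably. *)
Lemma deflation_of_left (S X : A) (f : hom S X) : F S ->
  exists (B : A) (i : hom S B) (p : hom B S) (g : hom B X),
    [/\ F B, deflation g, g ∘ i = f, stab g = stab (f ∘ p)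
      & stab i ∘ stab p = idm (B : stable_category A)].
Proof.
move=> FS; have [P [d [oP dd]]] := projective_cover frobA X.
have [_ /(_ S P) [B [i [j [p [q bip]]]]]] := exact_additive A.
have dg := biproduct_deflation f bip dd.
case: bip => pi1 qj1 pj0 qi0 ipjq1.
have ip1 : stab i ∘ stab p = idm (B : stable_category A).
  rewrite -stab_comp -[RHS]/(stab (idm B)) -ipjq1 stabD.
  by rewrite (stab_comp j) (stab_to_omega q) // comp0r addr0.
exists B, i, p, (f ∘ p + d ∘ q); split=> //.
- exact: left_stable_retract FS ip1.
- by rewrite compDl -!compA pi1 qi0 comp0r compm1 addr0.
- by rewrite stabD (stab_comp d) (stab_from_omega d) // comp0l addr0.
Qed.

Lemma deflation_precover (X : A) : exists (S : A) (f : hom S X),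
  [/\ F S, deflation f
    & forall (T : A) (t : hom T X), F T -> exists h, f ∘ h = t].
Proof.
have [S [f [FS pf]]] := preF X.
have [B [i [p [g [FB dg gi _ _]]]]] := deflation_of_left f FS.
exists B, g; split=> // T t /pf - /(_ t) [h <-].
by exists (i ∘ h); rewrite compA gi.
Qed.

(** Let [f : S -> X] be a deflation precover with kernel [K], and [m : S' -> K]
    a precover. In the stable category let [u : S -> S''] be the cone of
    [S' -> K -> S]. It kills every map from [F] which [f] kills, as such a map
    lifts to [K] and then to [S']. Moreover [f] factors through [u], and the
    second factor comes back to [S] through the precover, because [S''] is
    again in [F]. *)
Lemma weak_coreflection (X : A) :
  exists (S S'' : A) (f : hom S X) (u : hom S S'') (v : hom S'' S),
    [/\ F S, deflation f,
        forall (T : A) (t : hom T X), F T -> exists h, f ∘ h = t,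
        forall (T : A) (t : hom T S), F T -> stab (f ∘ t) = 0 -> stab (u ∘ t) = 0
      & f ∘ (v ∘ u) = f].
Proof.
have [S [f [FS df pf]]] := deflation_precover X.
have [K [k kf]] := df.
have [S' [m [FS' pm]]] := preF K.
have [W [D [w [d [oW wd]]]]] := injective_hull frobA S'.
have [S'' [u [h [po _]]]] := inflation_pushout (k ∘ m) (conflation_inflation wd).
have [c [_ uc]] := pushout_conflation wd po.
have FD : F D := left_cone wd FS' (left_omega oW).
have FS'' : F S'' := left_extension uc FS FD.
have [|g [[_ gu] _]] := po.2 _ 0 f.
  by rewrite compA (conflation_comp0 kf) !comp0l.
have [v fv] := pf _ g FS''.
exists S, S'', f, u, v; split=> //; last by rewrite compA fv.
move=> T t FT ft0; have [b fb b0] := stab0_lift ft0 df.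
have [|t' kt'] := conflation_lift (t := t - b) kf.
  by rewrite compBr fb subrr.
have [t'' mt''] := pm _ t' FT.
rewrite -(subrK b t) -kt' -mt'' compDr stabD (stab_comp u b) b0 comp0r addr0.
rewrite !compA -(compA u k m) -po.1 -compA (stab_comp h).
by rewrite (stab_from_omega h) // comp0l.
Qed.

Hypothesis splitA : idempotent_complete (stable_category A).

(** In the weak coreflection above, [v u - 1] is killed by [f], hence by [u] in
    the stable category: [u v u = u], so [v u] is a stable idempotent. Its image
    is a stable summand of [S], hence lies in [F], and on it [f] has become
    injective on stable maps from [F]. *)
Lemma coreflection (X : A) : exists (S : A) (f : hom S X),
  [/\ F S, deflation f,
      forall (T : A) (t : hom T X), F T -> exists h, f ∘ h = t
    & forall (T : A) (t : hom T S), F T -> stab (f ∘ t) = 0 -> stab t = 0].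
Proof.
have [S [S'' [f [u [v [FS df pf kf fvu]]]]]] := weak_coreflection X.
have uvu : stab u ∘ (stab v ∘ stab u) = stab u.
  have := kf S (v ∘ u - idm S) FS.
  rewrite compBr fvu compm1 subrr stab0 => /(_ erefl).
  rewrite compBr compm1 -(stab0 S S'') => /stab_eq; rewrite subr0 => /stab_eq.
  by rewrite !stab_comp.
have [|S0 [r' [s' [sr rs]]]] := splitA (e := stab v ∘ stab u).
  by rewrite -!compA uvu.
have [r er] := stab_surj r'; have [s es] := stab_surj s'.
rewrite -{}er -{}es in sr rs.
have FS0 : F S0 := left_stable_retract FS rs.
have [B [i [p [g [FB dg gi gp ip]]]]] := deflation_of_left (f ∘ s) FS0.
exists B, g; split=> // T t FT.
  (* [t] lifts along [f] to [h]; stably [h] may be replaced by [s r h], and the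
     remaining error, being stably zero, lifts along the deflation [g]. *)
  have [h fh] := pf _ t FT.
  have : stab t = stab (f ∘ s ∘ r ∘ h).
    rewrite !stab_comp -(compA (stab f)) sr -fh stab_comp; congr (_ ∘ _).
    by rewrite -!stab_comp fvu.
  move/stab_eq/stab_eq0 => e0; have [l gl _] := stab0_lift e0 dg.
  exists (l + i ∘ (r ∘ h)).
  by rewrite compDr gl (compA g i) gi !compA subrK.
rewrite stab_comp gp -stab_comp -!compA => /(kf _ _ FT) ut.
have pt0 : stab (p ∘ t) = 0.
  rewrite -(comp1m (stab (p ∘ t))) -rs -(comp1m (stab r)) -rs.
  rewrite -!compA -(stab_comp s) (compA (stab s)) sr -(compA (stab v)) -stab_comp ut.
  by rewrite !comp0r.
by rewrite -(comp1m (stab t)) -ip -compA -stab_comp pt0 comp0r.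
Qed.

(** Push an extension of [T] in [F] by [C0] out along [c] to an extension [M]
    of [T] by [S]. As [M] lies in [F], the map [M -> X] induced by [f] lifts to
    [S], and by injectivity of the coreflection the lift is stably a retraction
    of [S -> M]. Composing a genuine retraction with [E -> M] and correcting it
    by a map through [T] gives a retraction onto [C0]. *)
Lemma coreflection_kernel (C0 S X : A) (c : hom C0 S) (f : hom S X) :
  F S -> conflation c f ->
  (forall (T : A) (t : hom T X), F T -> exists h, f ∘ h = t) ->
  (forall (T : A) (t : hom T S), F T -> stab (f ∘ t) = 0 -> stab t = 0) ->
  C C0.
Proof.
move=> FS cf pf inj; apply/(cotFC.2 _) => T FT e.
have kq := ext_conflation e; set k := ext_infl e in kq; set q := ext_defl e in kq.
have [M [j [l [po _]]]] := inflation_pushout c (conflation_inflation kq).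
have [q' [q'l jq']] := pushout_conflation kq po.
have FM : F M := left_extension jq' FS FT.
have [|g [[gl gj] _]] := po.2 _ 0 f.
  by rewrite (conflation_comp0 cf) comp0l.
have [h fh] := pf _ g FM.
have [|a aj _] := @stab0_extend _ _ _ _ j (h ∘ j - idm S) _ (conflation_inflation jq').
  by apply: inj => //; rewrite compBr compA fh gj compm1 subrr stab0.
pose h' := h - a.
have h'j : h' ∘ j = idm S by rewrite compBl aj opprB addrC subrK.
have h'lk : h' ∘ l ∘ k = c by rewrite -compA po.1 compA h'j comp1m.
have [|y yq] := conflation_desc (t := f ∘ (h' ∘ l)) kq.
  by rewrite -compA h'lk (conflation_comp0 cf).
have [t ft] := pf _ y FT.
have [|rho crho] := conflation_lift (t := h' ∘ l - t ∘ q) cf.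
  by rewrite compBr (compA f t) ft yq subrr.
apply: (retraction_section (r := rho) kq); apply: (conflation_mono cf).
rewrite compA crho compBl h'lk -compA (conflation_comp0 kq).
by rewrite comp0r subr0 compm1.
Qed.

(** If [C0 -> S -> D] is a conflation and [W -> D] a map from [W] in [omega],
    the pullback is stably [C0]: it is an extension of the projective [W] by
    [C0], so its identity is a sum of maps through [C0] and through the
    injective [W]. *)
Lemma right_pullback (C0 S D W P : A) (c : hom C0 S) (f : hom S D)
    (d : hom W D) (q : hom P W) (g : hom P S) :
  C C0 -> conflation c f -> omega W -> is_pullback f d q g -> C P.
Proof.
move=> CC0 cf oW pb; apply/(cotFC.2 _) => T FT e.
have kp := ext_conflation e; set k := ext_infl e in kp; set p := ext_defl e in kp.
have [c' [gc' c'q]] := pullback_conflation cf pb.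
have [s qs] := oW.1 _ _ _ (idm W) (conflation_deflation c'q).
have [|r c'r] := conflation_lift (t := idm P - s ∘ q) c'q.
  by rewrite compBr compm1 compA qs comp1m subrr.
have [r' r'k] := Ext1_zero_extend r ((cotFC.2 C0).1 CC0 T FT) kp.
have [q' q'k] := oW.2 _ _ _ q (conflation_inflation kp).
apply: (retraction_section (r := c' ∘ r' + s ∘ q') kp).
by rewrite compDl -!compA r'k q'k c'r subrK.
Qed.

(** The second family of conflations follows from the first, as in Salce's
    lemma, by pulling an injective hull [X -> W -> D] back along an
    approximation of [D]. *)
Theorem complete_of_precovering : complete_cotorsion_pair F C.
Proof.
have cover X : exists (C0 F0 : A) (i : hom C0 F0) (p : hom F0 X),
    [/\ C C0, F F0 & conflation i p].
  have [S [f [FS [C0 [c cf]] pf inj]]] := coreflection X.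
  by exists C0, S, c, f; split=> //; exact: (coreflection_kernel FS cf pf inj).
split=> // X.
have [W [D [w [d [oW wd]]]]] := injective_hull frobA X.
have [C0 [S [c [f [CC0 FS cf]]]]] := cover D.
have [P [q [g [pb _]]]] := deflation_pullback d (conflation_deflation cf).
have pb' : is_pullback d f g q.
  split=> [|T a b ab]; first by rewrite pb.1.
  have [t [[ga qb] u]] := pb.2 _ _ _ (esym ab).
  by exists t; split=> // t' [e1 e2]; apply: u.
have [i [_ ig]] := pullback_conflation wd pb'.
by exists P, S, i, g; split=> //; exact: (right_pullback CC0 cf oW pb).
Qed.

End Aisle.

Theorem proposition5p5 (A : exact_category) (I J : ideal A) :
  frobenius A ->
  idempotent_complete (stable_category A) ->
  ideal_cotorsion_pair I J ->
  object_ideal I ->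
  object_ideal J ->
  t_structure_type (Ob I) (Ob J) ->
  (precovering I -> complete_cotorsion_pair (Ob I) (Ob J)) /\
  (complete_ideal_pair I J -> complete_cotorsion_pair (Ob I) (Ob J)).
Proof.
move=> frobA splitA cotIJ oI oJ tIJ.
have main : precovering I -> complete_cotorsion_pair (Ob I) (Ob J).
  move=> /(precovering_Ob oI) preI.
  have cotFC := Ob_cotorsion_pair cotIJ oI oJ.
  exact: complete_of_precovering cotFC tIJ preI splitA.
split=> // -[covers _]; apply: main => X.
by have [E [p [pE _]]] := covers X; exists E, p.
Qed.
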